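(* Let $\hat A$ be an auxiliary matrix, $\mathcal D\subseteq\mathcal V$ a set of vertices, $\mathcal C$ a partition of $\mathcal V\setminus\mathcal D$ into agglomerates, $P$ the corresponding tentative prolongation, $\hat D$ the (block) diagonal matrix of $\hat A$, and $$K_{TG}=\sup_{v\in(\ker\hat A)^\perp,\ v\neq0}\frac{v^T\hat D\big(I-P(P^T\hat DP)^\dagger P^T\hat D\big)v}{v^T\hat Av}.$$ For every $C\in\mathcal C$ let $\hat D_C$ be the diagonal block of $\hat D$ associated to vertices in $C$, and let $P_C\in(\mathbb R^{k\times k})^{|C|\times1}$ be the block of $P$ associated to $C$. For $\delta\in\{0,1\}$, let $\mu_g^\delta(C)$ be the smallest constant such that for all $v_C=(v_i)_{v_i\in C}\in(\mathbb R^k)^{|C|}$ $$\inf_{w\in\mathbb R^k}\|v_C-P_Cw\|_{\hat D_C}^2\le\mu_g^\delta(C)\Big(\sum_{v_i\in C}\|v_i\|_{M^i}^2+\sum_{v_i\ne v_j\in C}\|Q^{ij}v_i-Q^{ji}v_j\|_{E^{ij}}^2+\frac\delta2\sum_{v_j\notin C}\inf_{w\in\mathbb R^k}\sum_{v_i\in C}\|Q^{ij}v_i-Q^{ji}w\|_{E^{ij}}^2\Big),$$ and for $v_i\in\mathcal D$ let $$\mu_{\mathcal D}(v_i):=\sup_{x\in\mathbb R^k}\frac{x^T\hat D_{ii}x}{x^TM^ix},$$ i.e. the smallest constant with $x^T\hat D_{ii}x\le\mu_{\mathcal D}(v_i)\,x^TM^ix$ for all $x\in\mathbb R^k$. Then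 $$K_{TG}\le\max\Big\{\sup_{v_i\in\mathcal D}\mu_{\mathcal D}(v_i),\ \sup_{C\in\mathcal C}\mu_g^\delta(C)\Big\}.$$
   Context: Let $\mathcal V=\{v_i:i\in\mathcal I_f\}$ be a finite set of (fine) vertices, $k\in\mathbb N$; matrices are viewed as block matrices with $k\times k$ blocks indexed by pairs of vertices, vectors as having one block in $\mathbb R^k$ per vertex (a vertex and its block of a vector $v$ are both denoted $v_i$). For all vertices $v_i,v_j$ (fine or coarse) there is an invertible matrix $Q^{v_i\to v_j}\in\mathbb R^{k\times k}$, with $Q^{v_j\to v_l}Q^{v_i\to v_j}=Q^{v_i\to v_l}$ for all $i,j,l$, possessing a square root $Q^{ij}=\sqrt{Q^{v_i\to v_j}}$ with $Q^{ji}=(Q^{ij})^{-1}$. Auxiliary matrix. Given symmetric nonnegative edge matrices $E^{ij}=E^{ji}\in\mathbb R^{k\times k}$ ($i\ne j$) and symmetric nonnegative vertex matrices $M^i\in\mathbb R^{k\times k}$, the auxiliary matrix has blocks $\hat A_{ii}=M^i+\sum_{j\ne i}(Q^{ij})^TE^{ij}Q^{ij}$, $\hat A_{ij}=-(Q^{ij})^TE^{ij}Q^{ji}$ for $i\neq j$, so that $\|v\|_{\hat A}^2=\sum_{v_i}\|v_i\|_{M^i}^2+\sum_{v_i\ne v_j}\|Q^{ij}v_i-Q^{ji}v_j\|_{E^{ij}}^2$. Here and in the claim sums over $v_i\ne v_j$ run over unordered pairs, and $\|x\|_B^2=x^TBx$. Tentative prolongation. Given $\mathcal D\subseteq\mathcal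 V$ and a partition $\mathcal C=\{C_I:I\in\mathcal I_c\}$ of $\mathcal V\setminus\mathcal D$ into pairwise disjoint agglomerates, with a coarse vertex $v_I$ for every $C_I$, $P\in(\mathbb R^{k\times k})^{|\mathcal I_f|\times|\mathcal I_c|}$ has blocks $P_{iJ}=Q^{v_J\to v_i}$ if $v_i\in C_J$ and $P_{iJ}=0$ otherwise. Diagonal matrix $\hat D$. It is assumed that $(\ker\hat A)^\perp$ has an orthonormal basis of vectors each having nonzero entries at a single vertex only; with $E$ the (block diagonal) matrix having these as columns, $\tilde A=E^T\hat AE$ and $\tilde D$ the block diagonal of $\tilde A$ with respect to vertices, $\hat D=E\tilde DE^T$ is the block diagonal matrix of $\hat A$, with diagonal blocks $\hat D_{ii}=\hat A_{ii}$. ''Smallest constant'' is $+\infty$ if no finite constant exists. The sum over $v_j\notin C$ runs over all $v_j\in\mathcal V\setminus C$. $(\cdot)^\dagger$ is the Moore–Penrose pseudoinverse. *)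

(* Defs.v *)
From HB Require Import structures.
From mathcomp Require Import all_boot all_order all_algebra.
From mathcomp Require Import all_classical all_reals ereal.
Set Implicit Arguments.
Unset Strict Implicit.
Unset Printing Implicit Defensive.
Import Order.TTheory GRing.Theory Num.Theory.
Local Open Scope ring_scope.

(* The fine vertices are 'I_n, the coarse vertices 'I_m, and a general vertex
   is an element of 'I_n + 'I_m.  A block vector with one block in R^k per
   element of 'I_n is a column of height \sum_(i < n) k, its i-th block being
   [submxcol v i]; block matrices are handled with mxblock / submxblock. *)

Section MatrixNotions.
Variable R : realType.

(* ||x||_B^2 = x^T B x *)
Definition sqnorm d (B : 'M[R]_d) (x : 'cV[R]_d) : R :=
  (x^T *m B *m x) 0 0.

Definition sym_nonneg d (B : 'M[R]_d) : Prop :=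
  B^T = B /\ forall x : 'cV[R]_d, 0 <= sqnorm B x.

Definition ker_perp d (A : 'M[R]_d) : set 'cV[R]_d :=
  [set v | forall u : 'cV[R]_d, A *m u = 0 -> u^T *m v = 0]%classic.

Definition penrose a b (A : 'M[R]_(a, b)) (X : 'M[R]_(b, a)) : Prop :=
  [/\ A *m X *m A = A, X *m A *m X = X,
      (A *m X)^T = A *m X & (X *m A)^T = X *m A].

(* The Moore-Penrose pseudoinverse (not to be confused with [pinvmx], which is
   only some generalized inverse); see [mppinvP] and [penrose_unique]. *)
Definition mppinv a b (A : 'M[R]_(a, b)) : 'M[R]_(b, a) :=
  xget 0 [set X | penrose A X]%classic.

(* The smallest constant c >= 0 with f x <= c * g x for all x, and +oo if there
   is none.  It is only used for nonnegative f and g; the restriction to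
   nonnegative constants matters only if f = g = 0, when the value is 0. *)
Definition smallest_constant (T : Type) (f g : T -> R) : \bar R :=
  ereal_inf [set c%:E | c in [set c : R | 0 <= c /\ forall x, f x <= c * g x]]%classic.

End MatrixNotions.

Section Auxiliary.
Variables (R : realType) (k n m : nat).
Local Notation vertex := ('I_n + 'I_m)%type.

(* [Q u v] is Q^{u -> v}, and [S u v] is the square root Q^{uv}. *)
Definition transfer_family (Q S : vertex -> vertex -> 'M[R]_k) : Prop :=
  [/\ forall u v, Q u v \in unitmx,
      forall u v w, Q v w *m Q u v = Q u w,
      forall u v, S u v *m S u v = Q u v
    & forall u v, S v u = invmx (S u v)].

Definition fine_sqrt (S : vertex -> vertex -> 'M[R]_k) (i j : 'I_n) : 'M[R]_k :=
  S (inl i) (inl j).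

Definition edge_family (E : 'I_n -> 'I_n -> 'M[R]_k) : Prop :=
  forall i j, i != j -> sym_nonneg (E i j) /\ E i j = E j i.

Definition vertex_family (M : 'I_n -> 'M[R]_k) : Prop :=
  forall i, sym_nonneg (M i).

Definition aux_matrix (S : vertex -> vertex -> 'M[R]_k)
    (E : 'I_n -> 'I_n -> 'M[R]_k) (M : 'I_n -> 'M[R]_k) :
    'M[R]_(\sum_(i < n) k) :=
  \mxblock_(i < n, j < n)
    (if i == j
     then M i + \sum_(l < n | l != i)
                  (fine_sqrt S i l)^T *m E i l *m fine_sqrt S i l
     else - ((fine_sqrt S i j)^T *m E i j *m fine_sqrt S j i)).

(* [set C I | I : 'I_m] is a partition of the complement of D (into nonempty
   sets), and distinct indices give distinct, hence disjoint, agglomerates. *)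
Definition agglomeration (D : {set 'I_n}) (C : 'I_m -> {set 'I_n}) : Prop :=
  injective C /\ finset.partition [set C I | I : 'I_m] (~: D).

Definition prolongation (Q : vertex -> vertex -> 'M[R]_k)
    (C : 'I_m -> {set 'I_n}) : 'M[R]_(\sum_(i < n) k, \sum_(J < m) k) :=
  \mxblock_(i < n, J < m) (if i \in C J then Q (inr J) (inl i) else 0).

(* The columns of B are an orthonormal basis of (ker A)^perp, and the column
   with index a is supported at the single vertex [s a]. *)
Definition local_basis (A : 'M[R]_(\sum_(i < n) k)) r
    (B : 'M[R]_(\sum_(i < n) k, r)) (s : 'I_r -> 'I_n) : Prop :=
  [/\ B^T *m B = 1%:M,
      range (fun c : 'cV[R]_r => B *m c) = ker_perp A
    & forall (a : 'I_r) (i : 'I_n), i != s a -> submxcol (col a B) i = 0].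

(* B Dt B^T, where Dt is the block diagonal of B^T A B with respect to the
   vertices carrying the basis vectors.  See [submxblock_Dhat]. *)
Definition Dhat (A : 'M[R]_(\sum_(i < n) k)) r
    (B : 'M[R]_(\sum_(i < n) k, r)) (s : 'I_r -> 'I_n) :
    'M[R]_(\sum_(i < n) k) :=
  let At := B^T *m A *m B in
  let Dt := \matrix_(a < r, b < r) (if s a == s b then At a b else 0) in
  B *m Dt *m B^T.

Definition K_TG (A Dh : 'M[R]_(\sum_(i < n) k))
    (P : 'M[R]_(\sum_(i < n) k, \sum_(J < m) k)) : \bar R :=
  ereal_sup
    [set (sqnorm (Dh *m (1%:M - P *m mppinv (P^T *m Dh *m P) *m P^T *m Dh)) v
          / sqnorm A v)%:E
     | v in [set v | ker_perp A v /\ v <> 0]]%classic.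

(* Block vectors indexed by an agglomerate C are columns of height
   \sum_(a < #|C|) k, the block with index a belonging to [enum_val a]. *)
Definition diag_restr (Dh : 'M[R]_(\sum_(i < n) k)) (C : {set 'I_n}) :
    'M[R]_(\sum_(a < #|C|) k) :=
  \mxblock_(a < #|C|, b < #|C|) submxblock Dh (enum_val a) (enum_val b).

Definition prolongation_restr
    (P : 'M[R]_(\sum_(i < n) k, \sum_(J < m) k))
    (C : 'I_m -> {set 'I_n}) (I : 'I_m) : 'M[R]_(\sum_(a < #|C I|) k, k) :=
  \mxcol_(a < #|C I|) submxblock P (enum_val a) I.

(* Unordered pairs of vertices of C are enumerated by a < b. *)
Definition local_energy (S : vertex -> vertex -> 'M[R]_k)
    (E : 'I_n -> 'I_n -> 'M[R]_k) (M : 'I_n -> 'M[R]_k) (delta : bool)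
    (C : {set 'I_n}) (v : 'cV[R]_(\sum_(a < #|C|) k)) : R :=
  let vtx (a : 'I_#|C|) : 'I_n := enum_val a in
  \sum_(a < #|C|) sqnorm (M (vtx a)) (submxcol v a)
  + \sum_(a < #|C|) \sum_(b < #|C| | (a < b)%N)
      sqnorm (E (vtx a) (vtx b))
        (fine_sqrt S (vtx a) (vtx b) *m submxcol v a
         - fine_sqrt S (vtx b) (vtx a) *m submxcol v b)
  + delta%:R / 2 * \sum_(j < n | j \notin C)
      inf (range (fun w : 'cV[R]_k =>
        \sum_(a < #|C|)
          sqnorm (E (vtx a) j)
            (fine_sqrt S (vtx a) j *m submxcol v a
             - fine_sqrt S j (vtx a) *m w))).

Definition mu_g (S : vertex -> vertex -> 'M[R]_k)
    (E : 'I_n -> 'I_n -> 'M[R]_k) (M : 'I_n -> 'M[R]_k)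
    (Dh : 'M[R]_(\sum_(i < n) k))
    (P : 'M[R]_(\sum_(i < n) k, \sum_(J < m) k))
    (C : 'I_m -> {set 'I_n}) (delta : bool) (I : 'I_m) : \bar R :=
  smallest_constant
    (fun v : 'cV[R]_(\sum_(a < #|C I|) k) =>
       inf (range (fun w : 'cV[R]_k =>
         sqnorm (diag_restr Dh (C I)) (v - prolongation_restr P C I *m w))))
    (fun v => local_energy S E M delta v).

Definition mu_D (M : 'I_n -> 'M[R]_k) (Dh : 'M[R]_(\sum_(i < n) k))
    (i : 'I_n) : \bar R :=
  smallest_constant (fun x : 'cV[R]_k => sqnorm (submxblock Dh i i) x)
                    (fun x : 'cV[R]_k => sqnorm (M i) x).

End Auxiliary.

Section Facts.
Variable R : realType.

Lemma trmul_eq0 a b (X : 'M[R]_(a, b)) : X^T *m X = 0 -> X = 0.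
Proof.
move=> X0; apply/matrixP => i j; rewrite mxE.
have := congr1 (fun Y : 'M_b => Y j j) X0; rewrite !mxE => /eqP.
rewrite psumr_eq0; last by move=> l _; rewrite mxE -expr2 sqr_ge0.
by move=> /allP /(_ i (mem_index_enum _)) /=; rewrite mxE mulf_eq0 orbb => /eqP.
Qed.

Lemma gram_unit a b (X : 'M[R]_(a, b)) : row_free X -> X *m X^T \in unitmx.
Proof.
move=> Xfree; rewrite -row_free_unit -kermx_eq0.
have K0 : kermx (X *m X^T) *m (X *m X^T) = 0 by exact: mulmx_ker.
set K := kermx _ in K0 *.
have : K *m X = 0.
  rewrite -[K *m X]trmxK [(K *m X)^T]trmul_eq0 ?trmx0// trmxK trmx_mul.
  by rewrite mulmxA -(mulmxA K) K0 mul0mx.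
by move/eqP; rewrite mulmx_free_eq0.
Qed.

Lemma penrose_mul a c b (F : 'M[R]_(a, c)) (G : 'M[R]_(c, b)) :
  F^T *m F \in unitmx -> G *m G^T \in unitmx ->
  penrose (F *m G)
    (G^T *m invmx (G *m G^T) *m (invmx (F^T *m F) *m F^T)).
Proof.
move=> FU GU; set X := (X in penrose _ X).
have AX : F *m G *m X = F *m invmx (F^T *m F) *m F^T.
  by rewrite /X !mulmxA -(mulmxA F G) mulmxK.
have XA : X *m (F *m G) = G^T *m invmx (G *m G^T) *m G.
  by rewrite /X !mulmxA -(mulmxA _ F^T F) mulmxKV.
split.
- by rewrite AX mulmxA -(mulmxA _ F^T F) mulmxKV.
- by rewrite XA /X !mulmxA -(mulmxA _ G G^T) mulmxKV.
- by rewrite AX !trmx_mul trmx_inv trmx_mul !trmxK mulmxA.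
- by rewrite XA !trmx_mul trmx_inv trmx_mul !trmxK mulmxA.
Qed.

Lemma penrose_exists a b (A : 'M[R]_(a, b)) : exists X, penrose A X.
Proof.
eexists; rewrite -[X in penrose X](mulmx_base A); apply: penrose_mul.
  rewrite -{2}[col_base A]trmxK; apply: gram_unit.
  by rewrite /row_free mxrank_tr; exact: col_base_full.
exact/gram_unit/row_base_free.
Qed.

Lemma mppinvP a b (A : 'M[R]_(a, b)) : penrose A (mppinv A).
Proof.
have [X XP] := penrose_exists A.
exact: (@xgetPex _ 0 [set X | penrose A X]%classic (ex_intro _ X XP)).
Qed.

Lemma penrose_unique a b (A : 'M[R]_(a, b)) X Y :
  penrose A X -> penrose A Y -> X = Y.
Proof.
move=> [AXA XAX AX XA] [AYA YAY AY YA].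
have AXY : A *m X = A *m Y.
  rewrite -{1}AYA -[A *m Y *m A *m X]mulmxA -AX -AY -trmx_mul.
  by rewrite mulmxA AXA AY.
have XYA : X *m A = Y *m A.
  rewrite -{1}AYA -[A *m Y *m A]mulmxA mulmxA -XA -YA -trmx_mul.
  by rewrite -mulmxA [A *m (X *m A)]mulmxA AXA YA.
by rewrite -XAX -mulmxA AXY mulmxA XYA YAY.
Qed.

Lemma local_basis_proj k n (A : 'M[R]_(\sum_(i < n) k)) r
    (B : 'M[R]_(\sum_(i < n) k, r)) (s : 'I_r -> 'I_n) :
  local_basis A B s -> A *m (B *m B^T) = A.
Proof.
move=> [BB rB _]; apply/eqP; rewrite -subr_eq0 -{2}[A]mulmx1 -mulmxBr.
(* every row of A is orthogonal to ker A *)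
have At (x : 'cV_(\sum_(i < n) k)) : exists c, A^T *m x = B *m c.
  have : ker_perp A (A^T *m x).
    by move=> u Au; rewrite mulmxA -trmx_mul Au trmx0 mul0mx.
  by rewrite -rB => -[c _ <-]; exists c.
apply/eqP/row_matrixP => j; rewrite row0 row_mul; apply: trmx_inj.
rewrite trmx0 trmx_mul tr_row colE.
have [c ->] := At (delta_mx j 0).
rewrite linearB /= trmx_mul trmxK trmx1 mulmxBl mul1mx -mulmxA (mulmxA B^T).
by rewrite BB mul1mx subrr.
Qed.

Lemma submxblock_Dhat k n (A : 'M[R]_(\sum_(i < n) k)) r
    (B : 'M[R]_(\sum_(i < n) k, r)) (s : 'I_r -> 'I_n) :
  A^T = A -> local_basis A B s ->
  forall i j, submxblock (Dhat A B s) i j =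
              if i == j then submxblock A i j else 0.
Proof.
move=> As lB i j; have [BB rB sB] := lB.
have AE : A = B *m (B^T *m A *m B) *m B^T.
  have AP := local_basis_proj lB.
  have PA : B *m B^T *m A = A.
    by rewrite -[RHS]As -[in RHS]AP !trmx_mul As trmxK.
  by rewrite -!mulmxA AP !mulmxA PA.
have B0 a i' x : i' != s a -> B (tagnat.Rank i' x) a = 0.
  move=> /sB /matrixP /(_ x 0); by rewrite !mxE.
have -> : submxblock A i j = submxblock (B *m (B^T *m A *m B) *m B^T) i j.
  by rewrite -AE.
rewrite /Dhat; set At := B^T *m A *m B.
apply/matrixP => x y; rewrite (fun_if (fun X : 'M_k => X x y)) !mxE.
have [<-|ij] := eqVneq i j.
  apply: eq_bigr => b _; rewrite !mxE.
  have [/eqP sb|/B0 ->] := boolP (i == s b); last by rewrite !mulr0.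
  congr (_ * _); apply: eq_bigr => a _; rewrite !mxE.
  have [/eqP sa|/B0 ->] := boolP (i == s a); last by rewrite !mul0r.
  by rewrite -sa -sb eqxx.
apply: big1 => b _; rewrite !mxE.
have [/eqP sb|/B0 ->] := boolP (j == s b); last by rewrite mulr0.
rewrite big1 ?mul0r// => a _; rewrite !mxE.
have [/eqP sa|/B0 ->] := boolP (i == s a); last by rewrite mul0r.
by rewrite -sa -sb (negbTE ij) mulr0.
Qed.

End Facts.

(* Main.v *)
(* The numerator of [K_TG] is the minimum of [|v - P w|^2] in the [Dh]-seminorm.
   As [Dh] is block diagonal, this splits into one local minimization per
   agglomerate plus the terms [|v_i|^2] for [i] in [D], each bounded by a local
   energy.  The local energies add up to at most [v^T A v], because an edge
   between two different sets is charged at most half to each of them.  The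
   infima over [w] need not be known to be attained, so near-minimizers are
   chosen in every agglomerate. *)
Require Import Defs.
From mathcomp Require Import all_boot all_order all_algebra.
From mathcomp Require Import all_classical all_reals ereal.
From mathcomp Require Import ring lra.
Set Implicit Arguments.
Unset Strict Implicit.
Unset Printing Implicit Defensive.
Import Order.TTheory GRing.Theory Num.Theory.
Local Open Scope ring_scope.

(** * Semidefinite seminorms and the two-grid projection *)

Section Semidefinite.
Variable R : realType.

Lemma sqnorm0l d (x : 'cV[R]_d) : sqnorm 0 x = 0.
Proof. by rewrite /sqnorm mulmx0 mul0mx mxE. Qed.

Lemma sqnormMr d e (B : 'M[R]_d) (X : 'M[R]_(d, e)) (y : 'cV_e) :
  sqnorm B (X *m y) = sqnorm (X^T *m B *m X) y.
Proof. by rewrite /sqnorm trmx_mul !mulmxA. Qed.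

Lemma sqnormDl d (A B : 'M[R]_d) x : sqnorm (A + B) x = sqnorm A x + sqnorm B x.
Proof. by rewrite /sqnorm mulmxDr mulmxDl mxE. Qed.

Lemma sqnorm_suml d (I : finType) (P : pred I) (F : I -> 'M[R]_d) x :
  sqnorm (\sum_(i | P i) F i) x = \sum_(i | P i) sqnorm (F i) x.
Proof.
exact: (big_morph (fun B => sqnorm B x) (fun A B => sqnormDl A B x) (sqnorm0l x)).
Qed.

Lemma bilin_sym d (B : 'M[R]_d) (x y : 'cV_d) :
  B^T = B -> (x^T *m B *m y) 0 0 = (y^T *m B *m x) 0 0.
Proof.
move=> Bs; transitivity ((x^T *m B *m y)^T 0 0); first by rewrite [RHS]mxE.
by rewrite !trmx_mul Bs trmxK mulmxA.
Qed.

Lemma sqnormB d (B : 'M[R]_d) x y : B^T = B ->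
  sqnorm B (x - y) = sqnorm B x + sqnorm B y - 2 * (x^T *m B *m y) 0 0.
Proof.
move=> Bs; rewrite /sqnorm [(_ - _)^T]linearB /= !mulmxBl !mulmxBr.
by have := bilin_sym x y Bs; rewrite !mxE => ->; ring.
Qed.

Lemma sym_nonneg0 d : sym_nonneg (0 : 'M[R]_d).
Proof. by split=> [|x]; rewrite ?trmx0// sqnorm0l. Qed.

Lemma sym_nonnegD d (A B : 'M[R]_d) :
  sym_nonneg A -> sym_nonneg B -> sym_nonneg (A + B).
Proof.
move=> [As A0] [Bs B0]; split=> [|x]; first by rewrite linearD /= As Bs.
by rewrite sqnormDl addr_ge0.
Qed.

Lemma sym_nonneg_sum d (I : finType) (P : pred I) (F : I -> 'M[R]_d) :
  (forall i, P i -> sym_nonneg (F i)) -> sym_nonneg (\sum_(i | P i) F i).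
Proof. by move=> F0; apply: big_ind => //; [exact: sym_nonneg0|exact: sym_nonnegD]. Qed.

Lemma sym_nonneg_congr d e (B : 'M[R]_d) (X : 'M[R]_(d, e)) :
  sym_nonneg B -> sym_nonneg (X^T *m B *m X).
Proof.
move=> [Bs B0]; split=> [|x]; last by rewrite -sqnormMr.
by rewrite !trmx_mul trmxK Bs mulmxA.
Qed.

(** Move from [x] along [- B x]: with [x^T B x = 0], the seminorm of [x - t B x] is [t^2 b - 2 t a],
    where [a = |B x|^2]. If [a] were positive, this would be negative for small [t > 0]. *)
Lemma sym_nonneg_ker d (B : 'M[R]_d) (x : 'cV_d) :
  sym_nonneg B -> sqnorm B x = 0 -> B *m x = 0.
Proof.
move=> [Bs B0] x0; apply: trmul_eq0.
apply/matrixP => i j; rewrite !ord1 [RHS]mxE.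
set y := B *m x.
have yE : (x^T *m B *m y) 0 0 = (y^T *m y) 0 0 by rewrite /y trmx_mul Bs.
have a0 : 0 <= (y^T *m y) 0 0.
  by rewrite mxE sumr_ge0// => l _; rewrite mxE -expr2 sqr_ge0.
set a := (y^T *m y) 0 0 in yE a0 *; set b := sqnorm B y.
have b0 : 0 <= b by exact: B0.
have key t : 0 <= t ^+ 2 * b - 2 * t * a.
  have := B0 (x - t *: y); rewrite sqnormB// x0.
  have -> : sqnorm B (t *: y) = t ^+ 2 * b.
    rewrite /b /sqnorm [(t *: y)^T]linearZ /= -scalemxAr -!scalemxAl scalerA.
    by rewrite mxE expr2.
  by rewrite -scalemxAr mxE yE add0r mulrA.
have b1 : 0 < b + 1 by lra.
(* The minimizer of the quadratic is [a / b]; as [b] may vanish, [b + 1] replaces it, and the value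
   is still a negative multiple of [a ^+ 2]. *)
have := key (a / (b + 1)).
have -> : (a / (b + 1)) ^+ 2 * b - 2 * (a / (b + 1)) * a
          = - (a ^+ 2 * ((b + 2) / (b + 1) ^+ 2)).
  by field; rewrite gt_eqF.
rewrite oppr_ge0 => h; apply/eqP; rewrite -sqrf_eq0 eq_le sqr_ge0 andbT.
have q0 : 0 < (b + 2) / (b + 1) ^+ 2 by rewrite divr_gt0// ?exprn_gt0//; lra.
by rewrite -(pmulr_lle0 _ q0).
Qed.

Lemma sym_nonneg_kermx d e (B : 'M[R]_d) (X : 'M[R]_(d, e)) :
  sym_nonneg B -> X^T *m B *m X = 0 -> B *m X = 0.
Proof.
move=> B0 X0; apply/trmx_inj/row_matrixP => j; rewrite trmx0 row0.
apply: trmx_inj; rewrite trmx0 tr_row trmxK colE -mulmxA.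
apply: sym_nonneg_ker => //.
by rewrite sqnormMr X0 sqnorm0l.
Qed.

(** Transposition permutes the four Penrose equations of a symmetric matrix, so uniqueness
    applies. *)
Lemma trmx_mppinv d (A : 'M[R]_d) : A^T = A -> (mppinv A)^T = mppinv A.
Proof.
move=> As; apply: penrose_unique (mppinvP A).
have [AXA XAX AX XA] := mppinvP A; split.
- by apply: trmx_inj; rewrite !trmx_mul trmxK As mulmxA.
- by apply: trmx_inj; rewrite !trmx_mul trmxK As mulmxA.
- by rewrite trmx_mul trmxK As -XA trmx_mul As.
- by rewrite trmx_mul trmxK As -AX trmx_mul As.
Qed.

(* [1 - P X P^T B] is the [B]-orthogonal projection along the range of [P];
   the cross term vanishes because [B P (X P^T B P) = B P]. *)
Lemma sqnorm_twogrid_le d e (B : 'M[R]_d) (P : 'M[R]_(d, e))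
    (v : 'cV_d) (w : 'cV_e) : sym_nonneg B ->
  sqnorm (B *m (1%:M - P *m mppinv (P^T *m B *m P) *m P^T *m B)) v
    <= sqnorm B (v - P *m w).
Proof.
move=> B0; have [Bs Bnn] := B0; have [Gs _] := sym_nonneg_congr P B0.
have [G GE] : {G | P^T *m B *m P = G} by eexists.
rewrite GE in Gs *.
have [GXG XGX _ _] := mppinvP G; have Xs := trmx_mppinv Gs.
move: (mppinv G) GXG XGX Xs => X GXG XGX Xs.
(* With [Z = P (X G - 1)], the product [P^T B Z] equals [G X G - G = 0]. Hence [Z^T B Z = 0], and
   semidefiniteness gives [B Z = 0]. *)
have BPXG : B *m P *m X *m G = B *m P.
  apply/eqP; rewrite -subr_eq0 -!mulmxA -mulmxBr; apply/eqP.
  apply: sym_nonneg_kermx => //.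
  have -> : P *m (X *m G) - P = P *m (X *m G - 1%:M) by rewrite mulmxBr mulmx1.
  rewrite trmx_mul -!mulmxA (mulmxA B) (mulmxA P^T) (mulmxA P^T) GE.
  by rewrite mulmxBr mulmx1 (mulmxA G) GXG subrr mulmx0.
set y := P^T *m B *m v.
(* This is the transpose of [BPXG] applied to [v]: the coarse right-hand side [y] lies in the range
   of [G], so [X y] solves the coarse system. *)
have GXy : G *m X *m y = y.
  have := congr1 trmx BPXG; rewrite !trmx_mul Gs Xs Bs => GXPB.
  by rewrite /y -[in RHS]GXPB !mulmxA.
have cross (u : 'cV_e) : (v^T *m B *m (P *m u)) 0 0 = (y^T *m u) 0 0.
  by rewrite /y !trmx_mul Bs trmxK !mulmxA.
have lhsE : sqnorm (B *m (1%:M - P *m X *m P^T *m B)) v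
            = sqnorm B v - (y^T *m (X *m y)) 0 0.
  rewrite /sqnorm mulmxBr mulmx1 mulmxBr mulmxBl mxE [X in _ + X]mxE.
  by rewrite /y !trmx_mul Bs trmxK !mulmxA.
have q (u : 'cV_e) : sqnorm B (P *m u) = sqnorm G u by rewrite sqnormMr GE.
rewrite lhsE sqnormB// cross q.
(* The excess of the residual at [w] over its value at the optimal [X y] is exactly this square. *)
have : 0 <= sqnorm G (X *m y - w) by rewrite -q.
rewrite sqnormB//.
have -> : sqnorm G (X *m y) = (y^T *m (X *m y)) 0 0.
  by rewrite /sqnorm trmx_mul Xs -!mulmxA (mulmxA G) GXy mulmxA.
have -> : ((X *m y)^T *m G *m w) 0 0 = (y^T *m w) 0 0.
  by rewrite -{2}GXy !trmx_mul Xs Gs !mulmxA.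
by lra.
Qed.

End Semidefinite.

(** * Block decompositions and sums over agglomerates *)

Section Blocks.
Variable R : realType.

Lemma bilin_blocks k n (B : 'M[R]_(\sum_(i < n) k)) (x y : 'cV_(\sum_(i < n) k)) :
  (x^T *m B *m y) 0 0 =
  \sum_(i < n) \sum_(j < n)
    ((submxcol x i)^T *m submxblock B i j *m submxcol y j) 0 0.
Proof.
rewrite -{1}[B]submxblockK -{1}[x]submxcolK -{1}[y]submxcolK.
rewrite tr_mxcol mul_mxrow_mxblock mul_mxrow_mxcol summxE exchange_big /=.
by apply: eq_bigr => j _; rewrite mulmx_suml summxE.
Qed.

Lemma sqnorm_blockdiag k n (B : 'M[R]_(\sum_(i < n) k)) x :
  (forall i j, i != j -> submxblock B i j = 0) ->
  sqnorm B x = \sum_(i < n) sqnorm (submxblock B i i) (submxcol x i).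
Proof.
move=> B0; rewrite /sqnorm bilin_blocks; apply: eq_bigr => i _.
rewrite (bigD1 i)//= big1 ?addr0// => j ji.
by rewrite B0 1?eq_sym// mulmx0 mul0mx mxE.
Qed.

Lemma sym_nonneg_blockdiag k n (B : 'M[R]_(\sum_(i < n) k)) :
  (forall i j, i != j -> submxblock B i j = 0) ->
  (forall i, sym_nonneg (submxblock B i i)) -> sym_nonneg B.
Proof.
move=> B0 Bnn; split=> [|x]; last first.
  rewrite sqnorm_blockdiag//; apply: sumr_ge0 => i _.
  by have [_] := Bnn i; exact.
apply/mxblockP => i j; rewrite -tr_submxblock.
have [->|ij] := eqVneq i j; first by have [] := Bnn j.
by rewrite !B0 ?trmx0// eq_sym.
Qed.

Lemma sqnorm_diag_restr k n (B : 'M[R]_(\sum_(i < n) k)) (C : {set 'I_n}) x :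
  (forall i j, i != j -> submxblock B i j = 0) ->
  sqnorm (diag_restr B C) x =
  \sum_(a < #|C|) sqnorm (submxblock B (enum_val a) (enum_val a)) (submxcol x a).
Proof.
move=> B0; rewrite sqnorm_blockdiag => [|a b ab].
  by apply: eq_bigr => a _; rewrite mxblockK.
by rewrite mxblockK B0// (inj_eq enum_val_inj).
Qed.

(** The pairs with [j < i] become those with [i < j] after exchanging the indices. This passes from
    unordered edges to half-charges at both endpoints. *)
Lemma sum_ltn_sym n (F : 'I_n -> 'I_n -> R) : (forall i j, F i j = F j i) ->
  \sum_(i < n) \sum_(j < n | (i < j)%N) F i j =
  2^-1 * \sum_(i < n) \sum_(j < n | j != i) F i j.
Proof.
move=> Fs; rewrite [in RHS](eq_bigr (fun i : 'I_n => \sum_(j < n | (i < j)%N) F i j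
  + \sum_(j < n | (j < i)%N) F i j)); last first.
  move=> i _; rewrite (bigID (fun j : 'I_n => (i < j)%N)) /=.
  by congr (_ + _); apply: eq_bigl => j; rewrite -val_eqE /=; case: ltngtP.
rewrite big_split /= [X in _ + X](exchange_big_dep xpredT)//=.
rewrite [X in _ + X](_ : _ = \sum_(i < n) \sum_(j < n | (i < j)%N) F i j); last first.
  by apply: eq_bigr => i _; apply: eq_bigr => j _; rewrite Fs.
by field.
Qed.

(** The complement of [D] is summed block by block; injectivity of [C] allows the blocks to be
    indexed by ['I_m]. *)
Lemma agglomeration_sum n m (D : {set 'I_n}) (C : 'I_m -> {set 'I_n})
    (F : 'I_n -> R) : agglomeration D C ->
  \sum_(i < n) F i =
  \sum_(i in D) F i + \sum_(I < m) \sum_(a < #|C I|) F (enum_val a).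
Proof.
move=> [Cinj /and3P[/eqP Ccov Ctriv _]].
rewrite (bigID [in D]) /=; congr (_ + _).
rewrite -(eq_bigl _ _ (fun i => finset.in_setC i D)) -Ccov finset.big_trivIset//=.
rewrite big_imset /=; last by move=> ? ? _ _; exact: Cinj.
by apply: eq_bigr => I _; rewrite big_enum_val.
Qed.

End Blocks.

(** * Energy of the auxiliary matrix, distributed over vertices *)

Section Energy.
Variables (R : realType) (k n m : nat).
Variables (S : 'I_n + 'I_m -> 'I_n + 'I_m -> 'M[R]_k).
Variables (E : 'I_n -> 'I_n -> 'M[R]_k) (M : 'I_n -> 'M[R]_k).
Hypotheses (Eedge : edge_family E) (Mvertex : vertex_family M).

Definition edge_energy (v : 'cV[R]_(\sum_(i < n) k)) (i j : 'I_n) : R :=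
  sqnorm (E i j) (fine_sqrt S i j *m submxcol v i - fine_sqrt S j i *m submxcol v j).

Lemma edge_energy_sym v i j : edge_energy v i j = edge_energy v j i.
Proof.
(* The diagonal is treated apart because [edge_family] constrains only [E i j] with [i != j]. *)
have [->//|ij] := eqVneq i j; have [_ Es] := Eedge ij.
rewrite /edge_energy -Es -opprB.
by rewrite /sqnorm [(- _)^T]linearN /= mulNmx mulmxN mulNmx opprK.
Qed.

Lemma edge_energy_ge0 v i j : i != j -> 0 <= edge_energy v i j.
Proof. by move=> /Eedge[[_ E0] _]; exact: E0. Qed.

Lemma submxblock_aux i j : submxblock (aux_matrix S E M) i j =
  if i == j
  then M i + \sum_(l < n | l != i) (fine_sqrt S i l)^T *m E i l *m fine_sqrt S i l
  else - ((fine_sqrt S i j)^T *m E i j *m fine_sqrt S j i).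
Proof. exact: mxblockK. Qed.

Lemma aux_matrix_sym : (aux_matrix S E M)^T = aux_matrix S E M.
Proof.
apply/mxblockP => i j; rewrite -tr_submxblock !submxblock_aux eq_sym.
have [->|ij] := eqVneq i j.
  have [] : sym_nonneg (M j + \sum_(l < n | l != j)
      (fine_sqrt S j l)^T *m E j l *m fine_sqrt S j l); last by [].
  apply: sym_nonnegD => //; apply: sym_nonneg_sum => l lj.
  by apply: sym_nonneg_congr; rewrite eq_sym in lj; have [] := Eedge lj.
have [[Es _] Eij] := Eedge ij.
by rewrite linearN /= !trmx_mul trmxK -Eij Es mulmxA.
Qed.

Lemma aux_matrix_diag_nonneg i : sym_nonneg (submxblock (aux_matrix S E M) i i).
Proof.
rewrite submxblock_aux eqxx; apply: sym_nonnegD => //.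
apply: sym_nonneg_sum => l; rewrite eq_sym => /Eedge[+ _].
exact: sym_nonneg_congr.
Qed.

(** Each edge is charged half to either endpoint, so the total energy becomes a sum over vertices
    that can be regrouped by agglomerates. *)
Lemma sqnorm_aux_matrix v : sqnorm (aux_matrix S E M) v =
  \sum_(i < n) (sqnorm (M i) (submxcol v i)
                + 2^-1 * \sum_(j < n | j != i) edge_energy v i j).
Proof.
pose a i j := sqnorm (E i j) (fine_sqrt S i j *m submxcol v i).
pose c i j := ((fine_sqrt S i j *m submxcol v i)^T *m E i j
               *m (fine_sqrt S j i *m submxcol v j)) 0 0.
have eE i j : j != i -> edge_energy v i j = a i j + a j i - 2 * c i j.
  rewrite eq_sym => /Eedge[[Es _] Eij].
  by rewrite /edge_energy sqnormB// /a -Eij.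
(* Block row [i] contributes [a i j] from the diagonal block and [- c i j] off it. This matches half
   the edge energies only after summing over [i], where the [a j i] and [a i j] parts coincide. *)
have -> : sqnorm (aux_matrix S E M) v = \sum_(i < n) (sqnorm (M i) (submxcol v i)
    + (\sum_(j < n | j != i) a i j - \sum_(j < n | j != i) c i j)).
  rewrite /sqnorm bilin_blocks; apply: eq_bigr => i _.
  rewrite (bigD1 i)//= submxblock_aux eqxx -/(sqnorm _ _) sqnormDl sqnorm_suml.
  rewrite -addrA; congr (_ + _); rewrite -sumrN; congr (_ + _).
    by apply: eq_bigr => j _; rewrite -sqnormMr.
  apply: eq_bigr => j ji; rewrite submxblock_aux eq_sym (negbTE ji).
  by rewrite mulmxN mulNmx mxE /c trmx_mul !mulmxA.
rewrite !big_split /=; congr (_ + _).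
rewrite -mulr_sumr [in RHS](eq_bigr (fun i => \sum_(j < n | j != i) a i j
   + \sum_(j < n | j != i) a j i - 2 * \sum_(j < n | j != i) c i j)); last first.
  move=> i _; rewrite mulr_sumr -big_split /= -sumrB.
  by apply: eq_bigr => j ji; rewrite eE.
rewrite !big_split /= !sumrN -mulr_sumr.
rewrite [in X in 2^-1 * (_ + X - _)](exchange_big_dep xpredT)//=.
rewrite [in X in 2^-1 * (_ + X - _)](eq_bigr (fun i => \sum_(j < n | j != i) a i j)).
  by field.
by move=> i _; apply: eq_bigl => j; rewrite eq_sym.
Qed.

Definition restr_col (C : {set 'I_n}) (v : 'cV[R]_(\sum_(i < n) k)) :
  'cV[R]_(\sum_(a < #|C|) k) := \mxcol_(a < #|C|) submxcol v (enum_val a).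

(* A crossing edge is charged half to each side, by testing the infimum at
   [w = v_j]. *)
Lemma local_energy_le delta (C : {set 'I_n}) v :
  local_energy S E M delta (restr_col C v) <=
  \sum_(a < #|C|) (sqnorm (M (enum_val a)) (submxcol v (enum_val a))
     + 2^-1 * \sum_(j < n | j != enum_val a) edge_energy v (enum_val a) j).
Proof.
rewrite big_split /= /local_energy -addrA; apply: lerD.
  by rewrite le_eqVlt; apply/orP; left; apply/eqP; apply: eq_bigr => a _; rewrite mxcolK.
have -> : \sum_(a < #|C|) \sum_(b < #|C| | (a < b)%N)
      sqnorm (E (enum_val a) (enum_val b))
        (fine_sqrt S (enum_val a) (enum_val b) *m submxcol (restr_col C v) a
         - fine_sqrt S (enum_val b) (enum_val a) *m submxcol (restr_col C v) b)
   = 2^-1 * \sum_(a < #|C|) \sum_(b < #|C| | b != a)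
       edge_energy v (enum_val a) (enum_val b).
  rewrite -sum_ltn_sym => [|a b]; last exact: edge_energy_sym.
  by apply: eq_bigr => a _; apply: eq_bigr => b _; rewrite !mxcolK.
rewrite -mulr_sumr.
(* The half-charges of edges inside [C] reproduce the unordered inner sum exactly, so only the
   crossing edges remain to be compared. *)
have inE (a : 'I_#|C|) : \sum_(j < n | j != enum_val a) edge_energy v (enum_val a) j =
    \sum_(b < #|C| | b != a) edge_energy v (enum_val a) (enum_val b)
    + \sum_(j < n | j \notin C) edge_energy v (enum_val a) j.
  rewrite (bigID [in C]) /=; congr (_ + _).
    rewrite (eq_bigl (fun j => (j \in C) && (j != enum_val a))); last first.
      by move=> j; rewrite andbC.
    rewrite big_enum_val_cond; apply: eq_bigl => b.
    by rewrite (inj_eq enum_val_inj).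
  apply: eq_bigl => j; rewrite andb_idl//.
  by apply: contraNneq => ->; exact: enum_valP.
under [X in _ <= _ * X]eq_bigr do rewrite inE.
rewrite big_split /= mulrDr lerD2l -mulrA.
have out0 : 0 <= \sum_(a < #|C|) \sum_(j < n | j \notin C) edge_energy v (enum_val a) j.
  apply: sumr_ge0 => a _; apply: sumr_ge0 => j jC; apply: edge_energy_ge0.
  by apply: contraNneq jC => <-; exact: enum_valP.
(* For [delta = 0] the crossing charges on the right are simply dropped, being nonnegative. *)
case: delta => /=; last by rewrite mul0r mulr_ge0// invr_ge0.
rewrite mul1r ler_pM2l ?invr_gt0// exchange_big /=; apply: ler_sum => j jC.
apply: ge_inf; last first.
  by exists (submxcol v j) => //; apply: eq_bigr => a _; rewrite mxcolK.
exists 0 => _ [w _ <-]; apply: sumr_ge0 => a _.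
suff /Eedge[[_ E0] _] : enum_val a != j by exact: E0.
by apply: contraNneq jC => <-; exact: enum_valP.
Qed.

Lemma local_energy_ge0 delta (C : {set 'I_n}) (x : 'cV[R]_(\sum_(a < #|C|) k)) :
  0 <= local_energy S E M delta x.
Proof.
rewrite /local_energy !addr_ge0//.
- by apply: sumr_ge0 => a _; have [_] := Mvertex (enum_val a); exact.
- apply: sumr_ge0 => a _; apply: sumr_ge0 => b ab.
  suff /Eedge[[_ E0] _] : enum_val a != enum_val b by exact: E0.
  by rewrite (inj_eq enum_val_inj) -val_eqE ltn_eqF.
- rewrite mulr_ge0 ?divr_ge0//; apply: sumr_ge0 => j jC; apply: lb_le_inf.
    by apply: image_nonempty; exists 0.
  move=> _ [w _ <-]; apply: sumr_ge0 => a _.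
  suff /Eedge[[_ E0] _] : enum_val a != j by exact: E0.
  by apply: contraNneq jC => <-; exact: enum_valP.
Qed.

End Energy.

(** * Admissibility of the smallest constant *)

Section SmallestConstant.
Variables (R : realType) (T : Type) (f g : T -> R).

Lemma smallest_constant_ge0 : (0 <= smallest_constant f g)%E.
Proof. by apply/ereal_infP => _ [c [c0 _] <-]; rewrite lee_fin. Qed.

(** Slightly above the infimum there is an admissible constant; the slack vanishes in the limit for
    each fixed [x]. *)
Lemma smallest_constantP c : (forall x, 0 <= g x) ->
  (smallest_constant f g <= c%:E)%E -> forall x, f x <= c * g x.
Proof.
move=> g0 fgc x; apply/ler_addgt0Pr => e e0.
(* The slack multiplied by [g x] is at most [e], and the [+ 1] covers [g x = 0]. *)
have : (smallest_constant f g < (c + e / (g x + 1))%:E)%E.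
  by rewrite (le_lt_trans fgc)// lte_fin ltrDl divr_gt0// ltr_wpDl.
move=> /ereal_inf_lt[_ [d [d0 fd] <-]]; rewrite lte_fin => dc.
apply: (le_trans (fd x)); apply: (le_trans (ler_wpM2r (g0 x) (ltW dc))).
rewrite mulrDl lerD2l mulrAC ler_pdivrMr ?ltr_wpDl//.
by rewrite ler_pM2l// lerDl.
Qed.

End SmallestConstant.

(** * Decoupling of the coarse correction over agglomerates *)

Section TwoGrid.
Variables (R : realType) (k n m : nat).
Variables (Q : 'I_n + 'I_m -> 'I_n + 'I_m -> 'M[R]_k).
Variables (D : {set 'I_n}) (C : 'I_m -> {set 'I_n}).
Hypothesis aggl : agglomeration D C.
Local Notation P := (prolongation Q C).

Lemma agglomeration_cover i : i \notin D -> exists I, i \in C I.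
Proof.
case: aggl => _ /and3P[/eqP Ccov _ _] iD.
have : i \in finset.cover [set C I | I : 'I_m] by rewrite Ccov finset.in_setC.
by move=> /bigcupP[_ /imsetP[I _ ->]]; exists I.
Qed.

Lemma agglomeration_notin_D I i : i \in C I -> i \notin D.
Proof.
case: aggl => _ /and3P[/eqP Ccov _ _] iC.
rewrite -finset.in_setC -Ccov; apply/bigcupP; exists (C I) => //.
exact: imset_f.
Qed.

Lemma agglomeration_inj I J i : i \in C I -> i \in C J -> I = J.
Proof.
case: aggl => Cinj /and3P[_ /finset.trivIsetP Ctriv _] iI iJ.
apply: contrapT => /eqP IJ.
have CIJ : C I != C J by rewrite (inj_eq Cinj).
have /pred0P/(_ i) := Ctriv _ _ (imset_f C isT) (imset_f C isT) CIJ.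
by rewrite /= iI iJ.
Qed.

Lemma prolongation_row i (w : 'I_m -> 'cV[R]_k) :
  submxcol (P *m \mxcol_(J < m) w J) i =
  \sum_(J < m) submxblock P i J *m w J.
Proof.
rewrite /prolongation mul_mxblock_mxrow mxcolK.
by apply: eq_bigr => J _; rewrite mxblockK.
Qed.

Lemma prolongation_row_in I i (w : 'I_m -> 'cV[R]_k) : i \in C I ->
  submxcol (P *m \mxcol_(J < m) w J) i = submxblock P i I *m w I.
Proof.
move=> iI; rewrite prolongation_row (bigD1 I)//= big1 ?addr0// => J JI.
rewrite mxblockK ifN ?mul0mx//; apply: contraNN JI => iJ.
exact/eqP/(agglomeration_inj iJ iI).
Qed.

Lemma prolongation_row_D i (w : 'I_m -> 'cV[R]_k) : i \in D ->
  submxcol (P *m \mxcol_(J < m) w J) i = 0.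
Proof.
move=> iD; rewrite prolongation_row big1// => J _.
rewrite mxblockK ifN ?mul0mx//.
by apply: contraTN iD => /agglomeration_notin_D.
Qed.

(** Rows of [P] in [D] vanish and rows in [C I] see only [w I], so the blocks of [w] can be chosen
    independently. *)
Lemma sqnorm_residual (B : 'M[R]_(\sum_(i < n) k)) v (w : 'I_m -> 'cV[R]_k) :
  (forall i j, i != j -> submxblock B i j = 0) ->
  sqnorm B (v - P *m \mxcol_(J < m) w J) =
  \sum_(i in D) sqnorm (submxblock B i i) (submxcol v i)
  + \sum_(I < m) sqnorm (diag_restr B (C I))
                   (restr_col (C I) v - prolongation_restr P C I *m w I).
Proof.
move=> B0; rewrite sqnorm_blockdiag// (agglomeration_sum _ aggl); congr (_ + _).
  by apply: eq_bigr => i iD; rewrite submxcolB prolongation_row_D// subr0.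
apply: eq_bigr => I _; rewrite sqnorm_diag_restr//; apply: eq_bigr => a _.
rewrite !submxcolB (prolongation_row_in _ (enum_valP a)) mxcolK.
by rewrite /prolongation_restr mxcol_mul mxcolK.
Qed.

Variables (S : 'I_n + 'I_m -> 'I_n + 'I_m -> 'M[R]_k).
Variables (E : 'I_n -> 'I_n -> 'M[R]_k) (M : 'I_n -> 'M[R]_k).
Hypotheses (Eedge : edge_family E) (Mvertex : vertex_family M).

Lemma residual_le (B : 'M[R]_(\sum_(i < n) k)) delta c v :
  (forall i j, i != j -> submxblock B i j = 0) ->
  (forall i, sym_nonneg (submxblock B i i)) -> 0 <= c ->
  (forall i, i \in D -> (mu_D M B i <= c%:E)%E) ->
  (forall I, (mu_g S E M B P C delta I <= c%:E)%E) ->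
  forall e, 0 < e -> exists w,
    sqnorm B (v - P *m w) <= c * sqnorm (aux_matrix S E M) v + e.
Proof.
move=> B0 Bnn c0 muD muC e e0.
(* Each of the [m] agglomerates gets this slack, at most [e] in total; the [+ 1] covers [m = 0]. *)
have e1 : 0 < e / (m%:R + 1) by rewrite divr_gt0// ltr_wpDl.
have ex I : exists wI : 'cV[R]_k,
    sqnorm (diag_restr B (C I)) (restr_col (C I) v - prolongation_restr P C I *m wI)
    <= c * local_energy S E M delta (restr_col (C I) v) + e / (m%:R + 1).
  have := smallest_constantP (local_energy_ge0 S Eedge Mvertex delta (C := C I))
    (muC I) (restr_col (C I) v).
  set f := fun _ => _ => fc.
  have [_ [wI _ <-] /ltW wIe] : exists2 x, range f x & x < inf (range f) + e / (m%:R + 1).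
    apply: inf_adherent => //; split; first by apply: image_nonempty; exists 0.
    exists 0 => _ [wI _ <-]; rewrite /f sqnorm_diag_restr//.
    by apply: sumr_ge0 => a _; have [_] := Bnn (enum_val a); exact.
  by exists wI; apply: (le_trans wIe); rewrite lerD2r.
have [w wP] := choice ex; exists (\mxcol_(J < m) w J).
rewrite sqnorm_residual// sqnorm_aux_matrix// (agglomeration_sum _ aggl).
rewrite mulrDr -addrA; apply: lerD.
  (* At a vertex of [D] the term [M i] alone pays for the residual; the half-charges of its edges
     are discarded. *)
  rewrite mulr_sumr; apply: ler_sum => i iD.
  have Mge0 x : 0 <= sqnorm (M i) x by have [_] := Mvertex i; exact.
  apply: (le_trans (smallest_constantP Mge0 (muD i iD) _)).
  rewrite ler_wpM2l// lerDl mulr_ge0 ?invr_ge0//; apply: sumr_ge0 => j ji.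
  by apply: edge_energy_ge0; rewrite // eq_sym.
apply: (@le_trans _ _ (\sum_(I < m) (c * local_energy S E M delta (restr_col (C I) v)
    + e / (m%:R + 1)))); first exact: ler_sum.
rewrite big_split /= sumr_const card_ord; apply: lerD.
  rewrite mulr_sumr; apply: ler_sum => I _.
  by rewrite ler_wpM2l// local_energy_le.
by rewrite -[leLHS]mulr_natr mulrAC ler_pdivrMr ?ltr_wpDl// ler_pM2l// lerDl.
Qed.

End TwoGrid.

(** * The bound on the two-grid constant *)

Theorem theorem5p1 (R : realType) (k n m : nat)
    (Q S : 'I_n + 'I_m -> 'I_n + 'I_m -> 'M[R]_k)
    (E : 'I_n -> 'I_n -> 'M[R]_k) (M : 'I_n -> 'M[R]_k)
    (D : {set 'I_n}) (C : 'I_m -> {set 'I_n})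
    (r : nat) (B : 'M[R]_(\sum_(i < n) k, r)) (s : 'I_r -> 'I_n)
    (delta : bool) :
  transfer_family Q S ->
  edge_family E ->
  vertex_family M ->
  agglomeration D C ->
  local_basis (aux_matrix S E M) B s ->
  let A := aux_matrix S E M in
  let P := prolongation Q C in
  let Dh := Dhat A B s in
  (K_TG A Dh P <=
     Order.max
       (ereal_sup [set mu_D M Dh i | i in [set i : 'I_n | i \in D]]%classic)
       (ereal_sup [set mu_g S E M Dh P C delta I | I in [set: 'I_m]]%classic))%E.
Proof.
move=> _ Eedge Mvertex aggl lB; cbv zeta.
set A := aux_matrix S E M; set P := prolongation Q C; set Dh := Dhat A B s.
have DhE := submxblock_Dhat (aux_matrix_sym S Eedge Mvertex) lB.
have Dh0 i j : i != j -> submxblock Dh i j = 0.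
  by move=> ij; rewrite DhE (negbTE ij).
have Dhnn i : sym_nonneg (submxblock Dh i i).
  by rewrite DhE eqxx; exact: aux_matrix_diag_nonneg.
set mu := Order.max _ _.
have muD i : i \in D -> (mu_D M Dh i <= mu)%E.
  by move=> iD; rewrite le_max ereal_sup_ubound//; exists i.
have muC I : (mu_g S E M Dh P C delta I <= mu)%E.
  by rewrite le_max orbC ereal_sup_ubound//; exists I.
apply/ereal_supP => _ [v [_ v0] <-].
(* Suprema over empty index sets are [-oo]. A nonzero [v] forces a vertex to exist, and it lies in
   [D] or in some agglomerate, whose constant is nonnegative. *)
have mu0 : (0 <= mu)%E.
  have [i _] : exists i : 'I_n, True.
    apply: contrapT => n0; apply: v0; apply/mxcolP => i.
    by case: n0; exists i.
  have [/muD|/(agglomeration_cover aggl)[I _]] := boolP (i \in D).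
    exact/le_trans/smallest_constant_ge0.
  exact/(le_trans _ (muC I))/smallest_constant_ge0.
case: mu mu0 muD muC => [c|_ _ _|//]; last by rewrite leey.
rewrite !lee_fin => c0 muD muC.
have Ann : 0 <= sqnorm A v.
  rewrite sqnorm_aux_matrix//; apply: sumr_ge0 => i _; apply: addr_ge0.
    by have [_] := Mvertex i; exact.
  rewrite mulr_ge0 ?invr_ge0//; apply: sumr_ge0 => j ji.
  by apply: edge_energy_ge0; rewrite // eq_sym.
(* Division by zero yields [0], so a zero denominator gives a quotient below [c]. *)
have [->|Aneq0] := eqVneq (sqnorm A v) 0; first by rewrite invr0 mulr0.
rewrite ler_pdivrMr ?lt_neqAle ?Ann 1?eq_sym ?Aneq0//.
(* The arbitrary [e] absorbs the loss from using near-minimizers. *)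
apply/ler_addgt0Pr => e e0.
have [w] := residual_le aggl Eedge Mvertex (delta := delta) v Dh0 Dhnn c0 muD muC e0.
exact/le_trans/sqnorm_twogrid_le/sym_nonneg_blockdiag.
Qed.
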